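(* Let $K$ be a field, let $I\subset S=K[t_1,\ldots,t_s]$ be a monomial ideal with $\mathcal{G}(I)\subset K[V]$ for some $V\subset\{t_1,\ldots,t_s\}$, and let $\mathfrak{N}=(V)$ be the ideal of $S$ generated by $V$. The following hold. (a) For each $n\geq 1$, all the associated primes of $I^n$ are contained in $\mathfrak{N}$. (b) $I^nS_{\mathfrak{N}}\cap S=(IS_{\mathfrak{N}})^n\cap S=I^n$ for all $n\geq 1$.
   Context: $\mathcal{G}(I)$ is the minimal set of generators of the monomial ideal $I$ consisting of monomials. $S_{\mathfrak{N}}$ is the localization of $S$ at the prime ideal $\mathfrak{N}$. An associated prime of an ideal $L\subset S$ is a prime ideal of the form $(L\colon f)$ with $f\in S$. *)

(* Defs.v *)
From HB Require Import structures.
From mathcomp Require Import all_boot all_algebra fraction.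
From mathcomp Require Import boolp classical_sets.
From mathcomp Require Import mpoly.

Set Implicit Arguments.
Unset Strict Implicit.
Unset Printing Implicit Defensive.

Import GRing.Theory.

Local Open Scope ring_scope.
Local Open Scope classical_set_scope.

(* Ideals are Prop-valued sets rather than the boolean predicates of          *)
(* mathcomp's ring_quotient; moreover idealr_closed there only allows proper  *)
(* ideals, whereas the unit ideal has to be allowed here.                     *)

Section Ideals.
Variable R : comNzRingType.
Implicit Types (I J L P X : set R).

Definition is_ideal I : Prop :=
  [/\ I 0, (forall x y, I x -> I y -> I (x + y))
    & (forall a x, I x -> I (a * x))].

Definition is_prime_ideal P : Prop :=
  [/\ is_ideal P, ~ P 1 & forall x y, P (x * y) -> P x \/ P y].

Definition ideal_gen X : set R := smallest is_ideal X.

Definition ideal_mul I J : set R :=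
  ideal_gen [set z | exists x y, [/\ I x, J y & z = x * y]].

Definition ideal_exp I (n : nat) : set R := iter n (ideal_mul I) setT.

Definition colon L (f : R) : set R := [set g | L (g * f)].

Definition associated_prime L P : Prop :=
  is_prime_ideal P /\ exists f : R, P = colon L f.

Lemma ideal_gen_ideal X : is_ideal (ideal_gen X).
Proof.
split=> [J [[]] //|x y Ix Iy J JX|a x Ix J JX].
  by case: (JX) => -[_ JD _] _; apply: JD; [apply: Ix|apply: Iy].
by case: (JX) => -[_ _ JM] _; apply: JM; apply: Ix.
Qed.

End Ideals.

Record primeIdeal (R : comNzRingType) := PrimeIdeal {
  prime_set :> set R;
  prime_setP : is_prime_ideal prime_set }.

(* The localization of a domain R at a prime ideal P, realized as the subring *)
(* {a / b | a, b in R, b not in P} of the fraction field of R.                *)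

Section Localization.
Variables (R : idomainType) (P : primeIdeal R).

Definition in_localization : {pred {fraction R}} :=
  fun z => `[< exists a b : R, ~ prime_set P b /\ z = tofrac a / tofrac b >].

Lemma in_localizationP z :
  reflect (exists a b : R, ~ prime_set P b /\ z = tofrac a / tofrac b)
          (z \in in_localization).
Proof. exact: asboolP. Qed.

Lemma prime_compl_neq0 (b : R) : ~ prime_set P b -> tofrac b != 0.
Proof.
case: (prime_setP P) => -[P0 _ _] _ _ nPb; rewrite tofrac_eq0.
by apply/eqP => b0; apply: nPb; rewrite b0.
Qed.

Lemma prime_compl_mul (b d : R) : ~ prime_set P b -> ~ prime_set P d -> ~ prime_set P (b * d).
Proof. by case: (prime_setP P) => _ _ PM nPb nPd /PM[]. Qed.

Lemma in_localization_subring : subring_closed in_localization.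
Proof.
split.
- apply/in_localizationP; exists 1, 1; split; last by rewrite tofrac1 divr1.
  by case: (prime_setP P).
- move=> _ _ /in_localizationP[a [b [nPb ->]]] /in_localizationP[c [d [nPd ->]]].
  apply/in_localizationP; exists (a * d - c * b), (b * d).
  split; first exact: prime_compl_mul.
  rewrite -mulNr addf_div ?prime_compl_neq0 //.
  by rewrite tofracB !tofracM mulNr.
- move=> _ _ /in_localizationP[a [b [nPb ->]]] /in_localizationP[c [d [nPd ->]]].
  apply/in_localizationP; exists (a * c), (b * d).
  split; first exact: prime_compl_mul.
  by rewrite mulf_div !tofracM.
Qed.

HB.instance Definition _ :=
  GRing.isSubringClosed.Build {fraction R} in_localization
    in_localization_subring.

Record localization := Localization {
  loc_val : {fraction R};
  loc_valP : loc_val \in in_localization }.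

HB.instance Definition _ := [isSub for loc_val].
HB.instance Definition _ := [Choice of localization by <:].
HB.instance Definition _ :=
  [SubChoice_isSubComNzRing of localization by <:].

Lemma tofrac_in_localization (a : R) : tofrac a \in in_localization.
Proof.
apply/in_localizationP; exists a, 1; rewrite tofrac1 divr1; split=> //.
by case: (prime_setP P).
Qed.

Definition to_loc (a : R) : localization :=
  Localization (tofrac_in_localization a).

Lemma to_loc_is_zmod_morphism : zmod_morphism to_loc.
Proof. by move=> a b; apply: val_inj; rewrite raddfB /= rmorphB. Qed.

Lemma to_loc_is_monoid_morphism : monoid_morphism to_loc.
Proof.
split=> [|a b]; apply: val_inj; first by rewrite rmorph1 /= rmorph1.
by rewrite rmorphM /= rmorphM.
Qed.

HB.instance Definition _ :=
  GRing.isZmodMorphism.Build R localization to_loc to_loc_is_zmod_morphism.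
HB.instance Definition _ :=
  GRing.isMonoidMorphism.Build R localization to_loc to_loc_is_monoid_morphism.

Definition loc_extension (I : set R) : set localization :=
  ideal_gen (to_loc @` I).

Definition loc_contraction (J : set localization) : set R := to_loc @^-1` J.

End Localization.

Arguments to_loc {R} P a.
Arguments loc_extension {R} P I.
Arguments loc_contraction {R P} J.

Section Monomial.
Variables (K : fieldType) (s : nat).
Local Notation S := {mpoly K[s]}.
Implicit Types (I : set S) (M G : set S) (V : {set 'I_s}).

Definition monomials : set S := [set p | exists m : 'X_{1..s}, p = 'X_[m]].

Definition monomial_ideal I : Prop :=
  exists2 M : set S, M `<=` monomials & I = ideal_gen M.

Definition minimal_monomial_generators I G : Prop :=
  [/\ G `<=` monomials, ideal_gen G = I
    & forall H : set S, H `<=` G -> ideal_gen H = I -> H = G].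

(* The set G(I); the default value set0 is only reached when I is not a       *)
(* monomial ideal, see mingensP and mingens_uniq below.                       *)
Definition mingens I : set S := xget set0 (minimal_monomial_generators I).

(* A set of variables is given by the set V of their indices.                 *)
Definition subpolys V : set S :=
  [set p | forall m, m \in msupp p -> forall i, i \notin V -> m i = 0%N].

Definition var_ideal V : set S :=
  ideal_gen [set p | exists2 i, i \in V & p = 'X_i].

Lemma monomial_ideal_dvd M (m : 'X_{1..s}) : M `<=` monomials ->
  ideal_gen M 'X_[m] -> exists2 h, M 'X_[h] & (h <= m)%MM.
Proof.
move=> Mmon MX.
pose D : set S := [set p | forall k, k \in msupp p ->
  exists2 h, M 'X_[h] & (h <= k)%MM].
suff: D 'X_[m] by apply; rewrite msuppX inE.
apply: MX; split; last first.
  move=> g Mg; case: (Mmon g Mg) => h gE k; rewrite gE msuppX inE => /eqP ->.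
  by exists h; [rewrite -gE|exact: lepm_refl].
split=> [k|p q Dp Dq k /msuppD_le|a p Dp k /msuppM_le].
- by rewrite msupp0.
- by rewrite mem_cat => /orP[/Dp|/Dq].
- case/allpairsP=> -[u v] /= [_ /Dp[h Mh hv] ->]; exists h => //.
  exact: lepm_trans hv (lem_addl _ _).
Qed.

Lemma mingens_exists I : monomial_ideal I ->
  exists G, minimal_monomial_generators I G.
Proof.
case=> M Mmon IE; have [_ _ IM] := ideal_gen_ideal M.
pose G : set S := [set p | exists m, [/\ p = 'X_[m], I p
  & forall h, I 'X_[h] -> (h <= m)%MM -> h = m]].
have Gmon : G `<=` monomials by move=> p [m [-> _ _]]; exists m.
have GI : ideal_gen G = I.
  apply/seteqP; split; last first.
    rewrite IE; apply: smallest_sub; first exact: ideal_gen_ideal.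
    move=> p Mp; case: (Mmon p Mp) => m pE.
    have : I 'X_[m] by rewrite IE -pE; apply: sub_gen_smallest.
    rewrite {p Mp}pE; have [d] := ubnP (mdeg m).
    elim: d m => // d IHd m; rewrite ltnS => md Im.
    have [[h [Ih hm /eqP hNm]]|noh] := pselect (exists h,
      [/\ I 'X_[h], (h <= m)%MM & h <> m]); last first.
      apply: sub_gen_smallest; exists m; split=> // h Ih hm.
      by apply: contrapT => hNm; apply: noh; exists h.
    rewrite -(submK hm) mpolyXD; case: (ideal_gen_ideal G) => _ _; apply.
    apply: IHd Ih; apply: leq_trans md.
    rewrite -[X in (_ < mdeg X)%N](submK hm) mdegD -[X in (X < _)%N]add0n.
    rewrite ltn_add2r lt0n mdeg_eq0; apply: contraNneq hNm => hm0.
    by rewrite -(submK hm) hm0 add0m.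
  apply: smallest_sub; first by rewrite IE; apply: ideal_gen_ideal.
  by move=> p [m []].
exists G; split=> // H HG HI; apply/seteqP; split=> // p [m [pE Ip mmin]].
have Hmon : H `<=` monomials by apply: subset_trans Gmon.
have HX : ideal_gen H 'X_[m] by rewrite HI -pE.
have [h Hh hm] := monomial_ideal_dvd Hmon HX.
by rewrite pE -(mmin h) // -HI; apply: sub_gen_smallest.
Qed.

Lemma mingensP I : monomial_ideal I -> minimal_monomial_generators I (mingens I).
Proof. by move=> /mingens_exists; apply: xgetPex. Qed.

Lemma minimal_monomial_generators_sub I G H :
  minimal_monomial_generators I G -> H `<=` monomials -> ideal_gen H = I ->
  G `<=` H.
Proof.
case=> Gmon GI Gmin Hmon HI.
suff <- : G `&` H = G by move=> p [].
apply: (Gmin); first by move=> p [].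
have sub_ideal (X : set S) : is_ideal (ideal_gen X) by exact: ideal_gen_ideal.
apply/seteqP; split.
  by rewrite -GI; apply: smallest_sub => // p [Gp _]; apply: sub_gen_smallest.
rewrite -[X in X `<=` _]GI; apply: smallest_sub => // p Gp.
have [m pE] := Gmon p Gp; rewrite pE in Gp *.
have Hm : ideal_gen H 'X_[m] by rewrite HI -GI; apply: sub_gen_smallest.
have [h Hh hm] := monomial_ideal_dvd Hmon Hm.
have Gh : ideal_gen G 'X_[h] by rewrite GI -HI; apply: sub_gen_smallest.
have [g Gg gh] := monomial_ideal_dvd Gmon Gh.
have [gE|/eqP gNm] := pselect (g = m).
  have hmE : h = m.
    apply/mnmP => i; apply/eqP; rewrite eqn_leq (mnm_lepP hm) /=.
    by rewrite -gE (mnm_lepP gh).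
  by rewrite -hmE; apply: sub_gen_smallest; split=> //=; rewrite hmE.
(* 'X_[m] would be a redundant generator *)
suff GE : G `\ 'X_[m] = G by move: Gp; rewrite -GE => -[_ /(_ erefl)].
apply: (Gmin) => [q []//|]; rewrite -GI; apply/seteqP; split.
  by apply: smallest_sub => // q [Gq _]; apply: sub_gen_smallest.
apply: smallest_sub => // q Gq.
have [->|qNm] := pselect (q = 'X_[m]); last by apply: sub_gen_smallest.
have mE : 'X_[m] = 'X_[m - g] * 'X_[g] :> S.
  by rewrite -mpolyXD submK // (lepm_trans gh hm).
rewrite [X in ideal_gen _ X]mE; case: (sub_ideal (G `\ 'X_[m])) => _ _; apply.
apply: sub_gen_smallest; split=> //= /(congr1 (@msupp _ _)).
by rewrite !msuppX => -[gm]; rewrite gm eqxx in gNm.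
Qed.

Lemma mingens_uniq I G : minimal_monomial_generators I G -> mingens I = G.
Proof.
move=> IG; have IM : minimal_monomial_generators I (mingens I).
  by apply: xgetPex; exists G.
have [Gmon GI _] := IG; have [Mmon MI _] := IM.
by apply/seteqP; split; apply: minimal_monomial_generators_sub; eauto.
Qed.

Lemma var_ideal_prime V : is_prime_ideal (var_ideal V).
Proof.
pose t := [tuple (if i \in V then 0 else 'X_i : S) | i < s].
have VI : is_ideal (var_ideal V) by exact: ideal_gen_ideal.
have [V0 VD VM] := VI.
have kerV p : var_ideal V p -> p \mPo t = 0.
  move=> Vp; apply: (Vp [set p | p \mPo t = 0]); split.
    split=> [|x y /= hx hy|a x /= hx]; first exact: raddf0.
      by rewrite raddfD /= hx hy addr0.
    by rewrite rmorphM /= hx mulr0.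
  by move=> q [i iV ->] /=; rewrite comp_mpolyXU -tnth_nth tnth_mktuple iV.
have Vker p : var_ideal V (p - (p \mPo t)).
  have -> : p - (p \mPo t) =
      \sum_(m <- msupp p) (p@_m *: 'X_[m] - p@_m *: ('X_[m] \mPo t)).
    by rewrite sumrB; congr (_ - _); [exact: mpolyE|exact: comp_mpolyEX].
  elim/big_ind: _ => // m _; rewrite -scalerBr -mul_mpolyC; apply: (VM).
  have [[i iV mi]|noi] := pselect (exists2 i, i \in V & m i != 0%N).
    rewrite comp_mpolyX (bigD1 i) //= tnth_mktuple iV expr0n (negPf mi) mul0r.
    rewrite subr0 -(@submK _ U_(i) m) ?lep1mP // mpolyXD; apply: (VM).
    by apply: sub_gen_smallest; exists i.
  suff -> : 'X_[m] \mPo t = 'X_[m] by rewrite subrr.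
  rewrite comp_mpolyX [RHS]mpolyXE_id; apply: eq_bigr => i _.
  rewrite tnth_mktuple; case: ifP => // iV.
  suff -> : m i = 0%N by rewrite !expr0.
  by apply: contrapT => /eqP mi; apply: noi; exists i.
have VP p : p \mPo t = 0 -> var_ideal V p.
  by move=> pt; rewrite -[p]subr0 -pt.
split=> // [/kerV|x y /kerV].
  by rewrite rmorph1 => /eqP; rewrite oner_eq0.
rewrite rmorphM /= => /eqP; rewrite mulf_eq0 => /orP[] /eqP /VP; by [left|right].
Qed.

Definition var_prime V : primeIdeal S := PrimeIdeal (var_ideal_prime V).

End Monomial.

Arguments subpolys K {s} V.
Arguments var_ideal K {s} V.
Arguments var_prime K {s} V.

(* Main.v *)
Require Import Defs.
From HB Require Import structures.
From mathcomp Require Import all_boot all_algebra fraction.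
From mathcomp Require Import boolp classical_sets.
From mathcomp Require Import mpoly.
From mathcomp Require Import all_order zify.

Local Open Scope ring_scope.
Local Open Scope classical_set_scope.

Set Implicit Arguments.
Unset Strict Implicit.
Unset Printing Implicit Defensive.

Import Order.TTheory GRing.Theory.

(** Both parts say that a power of [I] does not notice inverting what lies
    outside the prime [N] generated by the variables of [V]: if [b] is not in
    [N] and [b * a] is in [I^n], then [a] is in [I^n] ([saturated]).

    This is [monomial_ideal_saturated], applied to [I^n]; the powers qualify
    because products of monomials in [K[V]] are again monomials in [K[V]]
    ([ideal_exp_monomials]). An ideal [J] generated by such monomials is
    recognized monomial by monomial, and whether a monomial is in [J] depends
    only on its exponents at [V] ([monomial_ideal_cancel]). Since [b] is not in
    [N], it has a monomial free of the variables of [V]. If [a] were not in [J],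
    compare lowest monomials for an order that looks at the degree in [V]
    first: the lowest monomial [u] of [b] is free of [V], and with [v] the
    lowest monomial of [a] outside [J], the product [u v] survives in [b * a].
    Hence [u v] is in [J], and so is [v], a contradiction.

    For (a), an element [x] of an associated prime [(I^n : f)] outside [N] would
    put [f] itself into [I^n], and the prime would contain [1]. For (b),
    extension of ideals along a ring morphism commutes with products
    ([ideal_gen_image_exp]), and [a / 1] lies in the extension of [J] only if
    some [b] outside [N] satisfies [b * a \in J] ([loc_contraction_extension]). *)

(** * Products and extensions of ideals given by generators *)

Lemma ideal_gen_sub (R : comNzRingType) (X J : set R) :
  is_ideal J -> X `<=` J -> ideal_gen X `<=` J.
Proof. exact: smallest_sub. Qed.

Lemma sub_ideal_gen (R : comNzRingType) (X : set R) : X `<=` ideal_gen X.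
Proof. exact: sub_gen_smallest. Qed.

Lemma ideal_genM (R : comNzRingType) (X : set R) a x :
  ideal_gen X x -> ideal_gen X (a * x).
Proof. by case: (ideal_gen_ideal X) => _ _; apply. Qed.

Lemma ideal_gen_setT (R : comNzRingType) (X : set R) :
  ideal_gen X 1 -> ideal_gen X = setT.
Proof.
by move=> X1; apply/seteqP; split=> // a _; rewrite -[a]mulr1; apply: ideal_genM.
Qed.

Lemma ideal_preimage (R R' : comNzRingType) (f : {rmorphism R -> R'})
  (J : set R') : is_ideal J -> is_ideal (f @^-1` J).
Proof.
case=> J0 JD JM; split=> [|x y Jx Jy|a x Jx] /=.
- by rewrite rmorph0.
- by rewrite rmorphD; apply: JD.
- by rewrite rmorphM; apply: JM.
Qed.

Lemma ideal_colon (R : comNzRingType) (J : set R) f :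
  is_ideal J -> is_ideal (colon J f).
Proof.
case=> J0 JD JM; split=> [|x y Jx Jy|a x Jx]; rewrite /colon /=.
- by rewrite mul0r.
- by rewrite mulrDl; apply: JD.
- by rewrite -mulrA; apply: JM.
Qed.

Lemma ideal_expS (R : comNzRingType) (I : set R) n :
  ideal_exp I n.+1 = ideal_mul I (ideal_exp I n).
Proof. by []. Qed.

Lemma ideal_mul_gen (R : comNzRingType) (X Y : set R) :
  ideal_mul (ideal_gen X) (ideal_gen Y) =
  ideal_gen [set z | exists x y, [/\ X x, Y y & z = x * y]].
Proof.
set XY := [set z | _].
apply/seteqP; split; apply: ideal_gen_sub; try exact: ideal_gen_ideal; last first.
  move=> z [x [y [Xx Yy ->]]]; apply: sub_ideal_gen.
  by exists x, y; split=> //; apply: sub_ideal_gen.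
move=> z [x [y [GXx GYy ->]]].
(* Bilinearity: the factors are reduced to generators one after the other. *)
apply: (ideal_gen_sub (ideal_colon y (ideal_gen_ideal XY)) _ GXx) => a Xa.
rewrite /colon /= mulrC.
apply: (ideal_gen_sub (ideal_colon a (ideal_gen_ideal XY)) _ GYy) => b Yb.
by rewrite /colon /= mulrC; apply: sub_ideal_gen; exists a, b.
Qed.

Lemma ideal_gen_image (R R' : comNzRingType) (f : {rmorphism R -> R'})
    (X : set R) :
  ideal_gen (f @` ideal_gen X) = ideal_gen (f @` X).
Proof.
apply/seteqP; split; apply: ideal_gen_sub; try exact: ideal_gen_ideal.
  move=> _ [x GXx <-].
  apply: (ideal_gen_sub (ideal_preimage f (ideal_gen_ideal (f @` X))) _ GXx).
  by move=> a Xa; apply: sub_ideal_gen; exists a.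
move=> _ [x Xx <-]; apply: sub_ideal_gen; exists x => //.
exact: sub_ideal_gen.
Qed.

(** Both sides are generated by the products [f x * f y], because products and
    images of ideals can be computed on generators. *)
Lemma ideal_gen_image_mul (R R' : comNzRingType) (f : {rmorphism R -> R'})
    (I J : set R) :
  ideal_gen (f @` ideal_mul I J) =
  ideal_mul (ideal_gen (f @` I)) (ideal_gen (f @` J)).
Proof.
rewrite ideal_gen_image ideal_mul_gen; congr ideal_gen.
apply/seteqP; split=> [_ [_ [x [y [Ix Jy ->]]] <-]|].
  by exists (f x), (f y); split; [exists x|exists y|rewrite rmorphM].
move=> _ [_ [_ [[x Ix <-] [y Jy <-] ->]]].
by exists (x * y); [exists x, y|rewrite rmorphM].
Qed.

Lemma ideal_gen_image_exp (R R' : comNzRingType) (f : {rmorphism R -> R'})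
    (I : set R) n :
  ideal_gen (f @` ideal_exp I n) = ideal_exp (ideal_gen (f @` I)) n.
Proof.
elim: n => [|n IHn]; last by rewrite !ideal_expS ideal_gen_image_mul IHn.
apply: ideal_gen_setT; apply: sub_ideal_gen; exists 1 => //; exact: rmorph1.
Qed.

(** * Ideals saturated with respect to the complement of a prime *)

Definition saturated (R : comNzRingType) (P J : set R) : Prop :=
  forall a b, ~ P b -> J (b * a) -> J a.

(** For [Q = (J : f)], an [x] in [Q] but not in [P] could be cancelled from
    [x * f], giving [f] in [J] and [Q] the unit ideal. *)
Lemma associated_prime_saturated (R : comNzRingType) (P J Q : set R) :
  saturated P J -> associated_prime J Q -> Q `<=` P.
Proof.
move=> satJ [[_ Q1 _] [f QE]] x Qx; apply: contrapT => nPx.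
apply: Q1; rewrite QE /colon /= mul1r; apply: satJ nPx _.
by move: Qx; rewrite QE.
Qed.

(** Clearing denominators: a finite sum of fractions with numerators in [J] has
    a common denominator outside [P]. *)
Lemma loc_extensionP (R : idomainType) (P : primeIdeal R) (J : set R) z :
  is_ideal J -> loc_extension P J z ->
  exists b c, [/\ ~ prime_set P b, J c & to_loc P b * z = to_loc P c].
Proof.
case=> J0 JD JM; have [_ nP1 _] := prime_setP P.
have locM a b : to_loc P (a * b) = to_loc P a * to_loc P b by exact: rmorphM.
have locD a b : to_loc P (a + b) = to_loc P a + to_loc P b by exact: rmorphD.
pose F : set (localization P) := [set z | exists b c,
  [/\ ~ prime_set P b, J c & to_loc P b * z = to_loc P c]].
suff FI : is_ideal F.
  apply: (ideal_gen_sub FI) => _ [a Ja <-].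
  by exists 1, a; split=> //; rewrite rmorph1 mul1r.
split.
- by exists 1, 0; split=> //; rewrite mulr0 rmorph0.
- move=> x y [b [c [nPb Jc bx]]] [b' [c' [nPb' Jc' by']]].
  exists (b * b'), (b' * c + b * c'); split; first exact: prime_compl_mul.
    by apply: JD; apply: JM.
  rewrite locD !locM -bx -by' mulrDr; congr (_ + _).
    by rewrite mulrA [to_loc P b * _]mulrC.
  by rewrite mulrA.
- move=> a x [b [c [nPb Jc bx]]].
  have /in_localizationP[u [d [nPd aE]]] := loc_valP a.
  exists (d * b), (u * c); split; [exact: prime_compl_mul|exact: JM|].
  have da : to_loc P d * a = to_loc P u.
    apply: val_inj; rewrite rmorphM /= aE mulrC divfK //.
    exact: prime_compl_neq0 nPd.
  by rewrite !locM -bx -da mulrACA.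
Qed.

Lemma to_loc_inj (R : idomainType) (P : primeIdeal R) : injective (to_loc P).
Proof.
move=> a b /(congr1 (@loc_val _ _)) /= /eqP.
by rewrite tofrac_eq => /eqP.
Qed.

Lemma loc_contraction_extension (R : idomainType) (P : primeIdeal R)
    (J : set R) :
  is_ideal J -> saturated (prime_set P) J ->
  loc_contraction (loc_extension P J) = J.
Proof.
move=> JI satJ; apply/seteqP; split=> [a|a Ja]; last first.
  by apply: sub_ideal_gen; exists a.
move=> /(loc_extensionP JI)[b [c [nPb Jc]]].
by rewrite -rmorphM => /to_loc_inj ba; apply: satJ nPb _; rewrite ba.
Qed.

(** * Monomial ideals generated in a subset of the variables *)

Section MonomialIdeals.
Variables (K : fieldType) (s : nat) (V : {set 'I_s}).
Local Notation S := {mpoly K[s]}.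
Implicit Types (M X : set S) (p g f : S) (m u v : 'X_{1..s}).

Lemma monomialsX m : @monomials K s 'X_[m].
Proof. by exists m. Qed.

Lemma subpolysX m :
  subpolys K V 'X_[m] <-> (forall i, i \notin V -> m i = 0%N).
Proof.
split=> [|Vm k]; last by move/mem_msuppXP <-.
by apply; apply/mem_msuppXP.
Qed.

Lemma ideal_gen_mpoly X p :
  (forall k, k \in msupp p -> ideal_gen X 'X_[k]) -> ideal_gen X p.
Proof.
move=> Xp; rewrite [p]mpolyE big_seq; have [X0 XD _] := ideal_gen_ideal X.
elim/big_ind: _ => // k /Xp Xk.
by rewrite -mul_mpolyC; apply: ideal_genM.
Qed.

Lemma monomial_ideal_msupp M p k : M `<=` @monomials K s ->
  ideal_gen M p -> k \in msupp p -> ideal_gen M 'X_[k].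
Proof.
move=> Mmon Mp.
pose D : set S := [set q | forall k, k \in msupp q -> ideal_gen M 'X_[k]].
suff: D p by apply.
apply: (ideal_gen_sub _ _ Mp) => [|q Mq].
  split=> [j|x y Dx Dy j /msuppD_le|a x Dx j /msuppM_le].
  - by rewrite msupp0.
  - by rewrite mem_cat => /orP[/Dx|/Dy].
  - case/allpairsP=> -[u v] /= [_ /Dx Mv ->].
    by rewrite mpolyXD; apply: ideal_genM.
have [m qE] := Mmon q Mq.
by move=> j; rewrite qE => /mem_msuppXP <-; rewrite -qE; apply: sub_ideal_gen.
Qed.

(** A generator dividing [u + v] involves only variables of [V], where [u]
    vanishes, so it already divides [v]. *)
Lemma monomial_ideal_cancel M u v :
  M `<=` @monomials K s `&` subpolys K V ->
  (forall i, i \in V -> u i = 0%N) ->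
  ideal_gen M 'X_[u + v] -> ideal_gen M 'X_[v].
Proof.
move=> MV uV MX; have Mmon : M `<=` @monomials K s by move=> q /MV[].
have [h Mh /mnm_lepP huv] := monomial_ideal_dvd Mmon MX.
have /MV[_ /subpolysX hV] := Mh.
have hv : (h <= v)%MM.
  apply/mnm_lepP => i; case: (boolP (i \in V)) => [iV|/hV -> //].
  by have := huv i; rewrite mnmDE uV.
by rewrite -(submK hv) mpolyXD; apply: ideal_genM; apply: sub_ideal_gen.
Qed.

(** Otherwise each monomial of [g] would be divisible by a variable of [V]. *)
Lemma var_ideal_msupp g : ~ var_ideal K V g ->
  exists2 u, u \in msupp g & forall i, i \in V -> u i = 0%N.
Proof.
move=> nVg; apply: contrapT => noV; apply: nVg.
apply: ideal_gen_mpoly => u gu; apply: contrapT => nVu.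
apply: noV; exists u => // i iV; apply: contrapT => /eqP ui.
apply: nVu; rewrite -(@submK _ U_(i) u) ?lep1mP // mpolyXD.
by apply: ideal_genM; apply: sub_ideal_gen; exists i.
Qed.

Definition vdeg m : nat := \sum_(i in V) m i.

Lemma vdegD u v : vdeg (u + v)%MM = (vdeg u + vdeg v)%N.
Proof. by rewrite -big_split; apply: eq_bigr => i _; rewrite mnmDE. Qed.

Lemma vdeg_eq0P u : reflect (forall i, i \in V -> u i = 0%N) (vdeg u == 0%N).
Proof.
rewrite sum_nat_eq0; apply: (iffP forall_inP) => uV i iV; first exact/eqP/uV.
by rewrite uV.
Qed.

(** Comparing the degree in [V] before anything else makes the lowest monomial of
    a polynomial outside the ideal [(V)] free of the variables of [V]; the ties
    are broken by the graded order of the monomials, which is also compatible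
    with addition. *)
Definition vkey m : nat *l 'X_{1..s} := (vdeg m, m).

(** A product of lowest monomials is reached in only one way, so its coefficient
    in the product of two polynomials cannot cancel. *)
Lemma vkeyD_eq u v u' v' : (vkey u <= vkey u')%O -> (vkey v <= vkey v')%O ->
  (u' + v')%MM = (u + v)%MM -> u' = u /\ v' = v.
Proof.
rewrite !lexi_pair => /andP[du lu] /andP[dv lv] E.
have dE : (vdeg u' + vdeg v' = vdeg u + vdeg v)%N by rewrite -!vdegD E.
rewrite !leEnat in du dv lu lv.
have {dv}vE : vdeg v' = vdeg v by lia.
have {du dE}uE : vdeg u' = vdeg u by lia.
rewrite uE vE !leqnn /= in lu lv.
have uu : u' = u.
  apply/eqP; move: lu; rewrite le_eqVlt => /predU1P[->//|/ltmc_le_add /(_ lv)].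
  by rewrite E ltxx.
by split=> //; move/eqP: E; rewrite uu eqm_add2l => /eqP.
Qed.

Lemma vkey_min (P : set 'X_{1..s}) (r : seq 'X_{1..s}) :
  (exists2 m, m \in r & P m) ->
  exists m, [/\ m \in r, P m
    & forall k, k \in r -> P k -> (vkey m <= vkey k)%O].
Proof.
elim: r => [|a r IHr] [m]; first by rewrite in_nil.
move=> mr Pm; have [[k kr Pk]|nor] := pselect (exists2 k, k \in r & P k).
  have {IHr}[|b [br Pb bmin]] := IHr; first by exists k.
  have [Pa|nPa] := pselect (P a); last first.
    exists b; split=> [||c]; rewrite ?inE ?br ?orbT //.
    by case/predU1P=> [->|]; [|apply: bmin].
  have [ab|/ltW ba] := leP (vkey a) (vkey b).
    exists a; split=> [||c]; rewrite ?inE ?eqxx //.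
    case/predU1P=> [->//|cr Pc]; exact: le_trans ab (bmin c cr Pc).
  exists b; split=> [||c]; rewrite ?inE ?br ?orbT //.
  by case/predU1P=> [->//|]; apply: bmin.
have nr k : k \in r -> ~ P k by move=> kr Pk; apply: nor; exists k.
have ma : m = a by move: mr; rewrite inE => /predU1P[//|/nr /(_ Pm)].
exists m; split=> // c; rewrite inE => /predU1P[-> _|/nr//]; first by rewrite ma.
Qed.

(** The monomial [v] is taken lowest among those of [f] outside the ideal rather
    than among all of them; the others cannot contribute to the coefficient of
    [u + v] in [g * f]. *)
Lemma monomial_ideal_saturated M :
  M `<=` @monomials K s `&` subpolys K V ->
  saturated (var_ideal K V) (ideal_gen M).
Proof.
move=> MV f g nVg Mgf; have Mmon : M `<=` @monomials K s by move=> q /MV[].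
apply: contrapT => nMf.
have [u [gu _ umin]] : exists u, [/\ u \in msupp g, setT u
    & forall k, k \in msupp g -> setT k -> (vkey u <= vkey k)%O].
  by apply: vkey_min; have [k gk _] := var_ideal_msupp nVg; exists k.
have uV : forall i, i \in V -> u i = 0%N.
  apply/vdeg_eq0P; have [k gk /vdeg_eq0P/eqP k0] := var_ideal_msupp nVg.
  by have := umin k gk I; rewrite lexi_pair k0 leEnat leqn0 => /andP[].
have [v [fv nMv vmin]] : exists v, [/\ v \in msupp f, ~ ideal_gen M 'X_[v]
    & forall k, k \in msupp f -> ~ ideal_gen M 'X_[k] -> (vkey v <= vkey k)%O].
  apply: vkey_min; apply: contrapT => nof; apply: nMf.
  apply: ideal_gen_mpoly => k fk; apply: contrapT => nMk.
  by apply: nof; exists k.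
apply: (nMv); apply: (monomial_ideal_cancel MV uV).
apply: (monomial_ideal_msupp Mmon Mgf).
rewrite mcoeff_msupp mcoeffM.
have ltS m m' : (mdeg m < (mdeg (m + m')%MM).+1)%N by rewrite mdegD ltnS leq_addr.
have ltS' m m' : (mdeg m' < (mdeg (m + m')%MM).+1)%N by rewrite addmC.
rewrite (bigD1 (BMultinom (ltS u v), BMultinom (ltS' u v))) //=.
rewrite big1 ?addr0 ?mulf_neq0 -?mcoeff_msupp // => -[u' v'] /=.
case/andP=> /eqP uvE neq; apply/eqP; rewrite mulf_eq0 !mcoeff_eq0.
rewrite -negb_and; apply: contra neq => /andP[gu' fv'].
(* A monomial of f in the ideal cannot occur: it would put u + v, hence v,
   into the ideal. *)
have nMv' : ~ ideal_gen M 'X_[v'].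
  move=> Mv'; apply: nMv; apply: (monomial_ideal_cancel MV uV).
  by rewrite uvE mpolyXD; apply: ideal_genM.
have [uE vE] := vkeyD_eq (umin _ gu' I) (vmin _ fv' nMv') (esym uvE).
by rewrite xpair_eqE -!val_eqE /= uE vE !eqxx.
Qed.

Lemma ideal_exp_monomials M n :
  M `<=` @monomials K s `&` subpolys K V ->
  exists2 Mn, Mn `<=` @monomials K s `&` subpolys K V
    & ideal_exp (ideal_gen M) n = ideal_gen Mn.
Proof.
move=> MV; elim: n => [|n [Mn MnV IHn]].
  exists [set 1]; last by symmetry; apply: ideal_gen_setT; apply: sub_ideal_gen.
  move=> _ ->; rewrite -mpolyX0; split; first exact: monomialsX.
  by apply/subpolysX => i _; rewrite mnm0E.
rewrite ideal_expS IHn ideal_mul_gen.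
eexists; last by [].
move=> _ [x [y [/MV[[m ->] mV] /MnV[[k ->] kV] ->]]].
rewrite -mpolyXD; split; first exact: monomialsX.
move/subpolysX in mV; move/subpolysX in kV.
by apply/subpolysX => i iV; rewrite mnmDE mV ?kV.
Qed.

End MonomialIdeals.

Theorem proposition5p1 (K : fieldType) (s : nat) (I : set {mpoly K[s]})
    (V : {set 'I_s})
    (I_monomial : monomial_ideal I)
    (gens_in_KV : mingens I `<=` subpolys K V) :
  let N := var_prime K V in
  (forall n : nat, (1 <= n)%N ->
     forall P : set {mpoly K[s]},
       associated_prime (ideal_exp I n) P -> P `<=` N)
  /\
  (forall n : nat, (1 <= n)%N ->
     loc_contraction (loc_extension N (ideal_exp I n))
       = loc_contraction (ideal_exp (loc_extension N I) n)
     /\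
     loc_contraction (ideal_exp (loc_extension N I) n) = ideal_exp I n).
Proof.
move=> N; have [Gmon GI _] := mingensP I_monomial.
have satI n : is_ideal (ideal_exp I n) /\ saturated N (ideal_exp I n).
  have [|M MV IE] := @ideal_exp_monomials K s V (mingens I) n.
    by move=> p Gp; split; [apply: Gmon|apply: gens_in_KV].
  rewrite -GI IE; split; first exact: ideal_gen_ideal.
  exact: monomial_ideal_saturated.
have extE n : loc_extension N (ideal_exp I n) = ideal_exp (loc_extension N I) n.
  exact: ideal_gen_image_exp.
split=> n _ => [P|]; first by apply: associated_prime_saturated; case: (satI n).
rewrite extE; split=> //; rewrite -extE.
by case: (satI n); apply: loc_contraction_extension.
Qed.
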